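(* Let $p\ge 3$ be a prime number. Let $G$ be a non-trivial finite group of order divisible only by primes at least $p$. Then $\alpha(G)\le 2/p$, with equality if and only if $G\cong C_p$. In particular, if $G$ is a non-trivial finite group of odd order, then $\alpha(G)\le 2/3$, with equality if and only if $G\cong C_3$.
   Context: For a finite group $H$, $c(H)$ denotes the number of cyclic subgroups of $H$ (including the trivial one) and $\alpha(H):=c(H)/|H|$. $C_m$ is the cyclic group of order $m$. *)

(* Defs.v *)
From mathcomp Require Import all_boot all_order all_algebra all_fingroup all_solvable.

Set Implicit Arguments.
Unset Strict Implicit.
Unset Printing Implicit Defensive.

Import GRing.Theory Num.Theory.

Definition num_cyclic (gT : finGroupType) (G : {group gT}) : nat :=
  #|[set H in subgroups G | cyclic H]|.

Definition cyclic_ratio (gT : finGroupType) (G : {group gT}) : rat :=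
  ((num_cyclic G)%:R / #|G|%:R)%R.

(* Main.v *)
Require Import Defs.
From mathcomp Require Import all_boot all_order all_algebra all_fingroup all_solvable.
From mathcomp Require Import zify.

(** Every cyclic subgroup H of G has [totient #|H|] generators, and distinct
    cyclic subgroups share none.  If all prime divisors of [#|G|] are at least
    p, a non-trivial H has at least [p - 1] generators: its order is coprime to
    [1, ..., p - 1].  So the [c(G) - 1] non-trivial cyclic subgroups use up at
    least [(c(G) - 1)(p - 1)] of the [n - 1] non-trivial elements of G, where
    [n = #|G|] ([card_nontrivial_cyclic]).  Moreover [p <= n], since G is
    non-trivial, and the two inequalities give

      [p (p - 1) c(G) <= p (n + p - 2) = 2 n (p - 1) - (p - 2) (n - p)],

    that is [p c(G) <= 2 n], strictly so when [p < n] because [p > 2].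
    Equality therefore forces [n = p], hence G cyclic of order p; conversely
    such a G has the two cyclic subgroups 1 and G, whence [p c(G) >= 2 n].
    The statement on odd orders is the case [p = 3]. *)

Set Implicit Arguments.
Unset Strict Implicit.
Unset Printing Implicit Defensive.

Import GRing.Theory Num.Theory.

Lemma leq_of_prime_divisors (p m : nat) :
  1 < m -> (forall q, prime q -> q %| m -> p <= q) -> p <= m.
Proof.
move=> m_gt1 p_min; apply: leq_trans (p_min _ (pdiv_prime m_gt1) (pdiv_dvd m)) _.
exact: dvdn_leq (ltnW m_gt1) (pdiv_dvd m).
Qed.

(** The residues [1, ..., p - 1] are all coprime to m: a common prime factor
    of m and d is at least p, so it cannot divide a positive [d < p]. *)
Lemma leq_predn_totient (p m : nat) :
  1 < m -> (forall q, prime q -> q %| m -> p <= q) -> p.-1 <= totient m.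
Proof.
move=> m_gt1 p_min; have p_le_m := leq_of_prime_divisors m_gt1 p_min.
case: p => // p in p_min p_le_m *.
rewrite totient_count_coprime (big_cat_nat (n := p.+1)) //=.
(* Only the residues below the bound matter; the residue 0 counts for nothing,
   and those beyond the bound may be discarded. *)
rewrite big_ltn // -addnA.
apply/(leq_trans _ (leq_addl _ _))/(leq_trans _ (leq_addr _ _)).
rewrite [leqLHS](_ : _ = \sum_(1 <= d < p.+1) 1); last first.
  by rewrite sum_nat_const_nat muln1 subn1.
rewrite big_nat [leqRHS]big_nat; apply: leq_sum => d /andP[d_gt0 d_ltp].
rewrite lt0b /coprime; apply: contraLR d_ltp => gcd_neq1.
have gcd_gt1 : 1 < gcdn m d.
  by rewrite ltn_neqAle eq_sym gcd_neq1 gcdn_gt0 d_gt0 orbT.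
have dvd_gcd := pdiv_dvd (gcdn m d).
rewrite -leqNgt; apply: (leq_trans (p_min _ (pdiv_prime gcd_gt1) _)).
  exact: dvdn_trans dvd_gcd (dvdn_gcdl _ _).
exact: dvdn_leq d_gt0 (dvdn_trans dvd_gcd (dvdn_gcdr _ _)).
Qed.

Section CyclicSubgroups.

Variables (gT : finGroupType) (G : {group gT}).
Implicit Type H : {group gT}.

Lemma num_cyclic_nontrivial :
  num_cyclic G = #|[set H in subgroups G | cyclic H & H :!=: 1%g]|.+1.
Proof.
rewrite /num_cyclic (cardsD1 1%G) !inE sub1G cyclic1 /= add1n; congr _.+1.
by apply: eq_card => H; rewrite !inE -val_eqE /= andbC -andbA.
Qed.

(** The non-trivial elements of G are partitioned by the cyclic subgroup that
    they generate, and each part is the set of generators of that subgroup. *)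
Lemma card_nontrivial_cyclic (p : nat) :
  (forall q, prime q -> q %| #|G| -> p <= q) ->
  (num_cyclic G).-1 * p.-1 <= #|G|.-1.
Proof.
move=> p_min; rewrite num_cyclic_nontrivial /=.
set C := [set H in subgroups G | _]; rewrite -sum_nat_const.
have ->: #|G|.-1 = #|G^#%g| by rewrite (cardsD1 1%g G) group1.
rewrite -sum1_card (partition_big (fun x => <[x]>%G) [in C]) /=; last first.
  by move=> x; rewrite !inE cycle_subG cycle_cyclic cycle_eq1 andbC.
apply: leq_sum => H; rewrite !inE => /and3P[sHG /cyclicP[x defH] ntH].
have dvdH : #|H| %| #|G| by apply: cardSg.
have H_gt1 : 1 < #|H| by rewrite cardG_gt1.
apply: (leq_trans (leq_predn_totient H_gt1 _)) => [q q_pr q_dvd|].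
  exact: p_min q_pr (dvdn_trans q_dvd dvdH).
rewrite sum1dep_card defH totient_gen; apply/subset_leq_card/subsetP => y.
rewrite !inE /generator -defH => /eqP defHy.
rewrite -cycle_eq1 -cycle_subG -defHy ntH sHG /=.
exact/eqP/val_inj.
Qed.

Lemma num_cyclic_ge2 : G :!=: 1%g -> cyclic G -> 2 <= num_cyclic G.
Proof.
move=> ntG cG; rewrite num_cyclic_nontrivial ltnS card_gt0.
by apply/set0Pn; exists G; rewrite !inE subxx cG ntG.
Qed.

Lemma cyclic_ratio_le (a b : nat) :
  0 < b -> (cyclic_ratio G <= a%:R / b%:R)%R = (num_cyclic G * b <= a * #|G|).
Proof.
move=> b_gt0; rewrite /cyclic_ratio ler_pdivrMr ?ltr0n ?cardG_gt0 //.
by rewrite mulrAC ler_pdivlMr ?ltr0n // -!natrM ler_nat.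
Qed.

Lemma cyclic_ratio_eq (a b : nat) :
  0 < b -> (cyclic_ratio G == a%:R / b%:R)%R = (num_cyclic G * b == a * #|G|).
Proof.
move=> b_gt0; rewrite /cyclic_ratio eqr_div ?pnatr_eq0 -?lt0n ?cardG_gt0 //.
by rewrite -!natrM eqr_nat.
Qed.

Lemma isog_Zp_prime (p : nat) : prime p -> (G \isog Zp p) = (#|G| == p).
Proof.
move=> p_pr; apply/idP/eqP => [/card_isog->|oG]; first exact/card_Zp/prime_gt0.
by rewrite isog_cyclic_card ?prime_cyclic ?oG // card_Zp ?prime_gt0 // eqxx.
Qed.

Lemma cyclic_ratio_bound (p : nat) :
    prime p -> 3 <= p -> G :!=: 1%g ->
    (forall q, prime q -> q %| #|G| -> p <= q) ->
  (cyclic_ratio G <= 2 / p%:R)%R /\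
  (cyclic_ratio G = (2 / p%:R)%R <-> G \isog Zp p).
Proof.
move=> p_pr p_ge3 ntG p_min; have p_gt0 := prime_gt0 p_pr.
have c_bound := card_nontrivial_cyclic p_min.
have p_le_n : p <= #|G| by apply: leq_of_prime_divisors p_min; rewrite cardG_gt1.
have c_gt0 : 0 < num_cyclic G by rewrite num_cyclic_nontrivial.
(* From c (p - 1) <= n + p - 2 and 0 <= (p - 2) (n - p); equality
   forces n = p because p > 2. *)
have c_le : num_cyclic G * p <= 2 * #|G| by nia.
split; first by rewrite cyclic_ratio_le.
rewrite isog_Zp_prime //; split=> [/eqP | /eqP oG].
  by rewrite cyclic_ratio_eq // => /eqP c_eq; apply/eqP; nia.
apply/eqP; rewrite cyclic_ratio_eq // eqn_leq c_le oG leq_pmul2r //.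
by rewrite num_cyclic_ge2 // prime_cyclic // oG.
Qed.

End CyclicSubgroups.

Theorem proposition1 :
  (forall p : nat, prime p -> (3 <= p)%N ->
   forall (gT : finGroupType) (G : {group gT}),
     G :!=: 1%g ->
     (forall q : nat, prime q -> (q %| #|G|)%N -> (p <= q)%N) ->
     (cyclic_ratio G <= 2 / p%:R)%R /\
     (cyclic_ratio G = (2 / p%:R)%R <-> G \isog Zp p))
  /\
  (forall (gT : finGroupType) (G : {group gT}),
     G :!=: 1%g -> odd #|G| ->
     (cyclic_ratio G <= 2 / 3)%R /\
     (cyclic_ratio G = (2 / 3)%R <-> G \isog Zp 3)).
Proof.
split=> [p p_pr p_ge3 gT G ntG p_min | gT G ntG oddG].
  exact: cyclic_ratio_bound.
apply: (@cyclic_ratio_bound _ _ 3) => // q q_pr q_dvd.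
by rewrite odd_prime_gt2 // (dvdn_odd q_dvd).
Qed.
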